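(* Let $V$ be a complex inner product space of dimension $n\geq 2$ with a fixed orthonormal basis $\{f_1,\ldots,f_n\}$, let $G$ be a subgroup of the symmetric group $S_m$, and let $\lambda$ be a complex irreducible character of $G$. For every $1\leq i\leq n$ and every $j\in\bar{\mathcal{D}}$, $$\dim V^{\lambda}_{ij}=\lambda(1)\,[\lambda,1_{G_j}].$$
   Context: $\times^m V$ is the Cartesian product of $m$ copies of $V$, with inner product $\langle (z_1,\ldots,z_m),(w_1,\ldots,w_m)\rangle=\sum_{i=1}^m\langle z_i,w_i\rangle$. For $1\le i\le n$, $1\le j\le m$, $f_{ij}\in\times^m V$ is the $m$-tuple whose $j$-th entry is $f_i$ and whose other entries are $0$. For $\tau\in G$, $Q(\tau):\times^m V\to\times^m V$ is the linear operator $Q(\tau)(u_1,\ldots,u_m)=(u_{\tau^{-1}(1)},\ldots,u_{\tau^{-1}(m)})$. The Cartesian symmetrizer is $C_\lambda=\frac{\lambda(1)}{|G|}\sum_{\tau\in G}\lambda(\tau)Q(\tau)$, and $f^\lambda_{ij}=C_\lambda(f_{ij})$. $G_j$ is the stabilizer of $j$ in $G$, $1_{G_j}$ its principal character, and $[\lambda,1_{G_j}]=\frac{1}{|G_j|}\sum_{g\in G_j}\lambda(g)$. $\mathcal{D}$ is a set of representatives of the orbits of $G$ acting on $\{1,\ldots,m\}$, $\mathcal{O}=\{j : 1\le j\le m,\ [\lambda,1_{G_j}]\neq 0\}$, and $\bar{\mathcal{D}}=\mathcal{D}\cap\mathcal{O}$. For $1\le i\le n$ and $j\in\bar{\mathcal{D}}$,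 the cyclic subspace $V^\lambda_{ij}$ is the linear span of $\{f^\lambda_{i\sigma(j)} : \sigma\in G\}$. *)

(* Defs.v *)
From HB Require Import structures.
From mathcomp Require Import all_boot all_order all_fingroup all_algebra.
From mathcomp Require Import mxrepresentation complex reals.

Set Implicit Arguments.
Unset Strict Implicit.
Unset Printing Implicit Defensive.

Import Order.TTheory GroupScope GRing.Theory Num.Theory.
Local Open Scope ring_scope.

(* MathComp's own characters take values in algC; to work over the complex
   numbers R[i] an irreducible character is the trace function of an
   irreducible representation over R[i]. Only the values on G matter.
   In 'S_m the product s * t is "s, then t"; with respect to the opposite
   convention for composition, transposing matrices turns representations
   into representations, so the irreducible characters are the same. *)
Definition irr_character (R : realType) (gT : finGroupType)
    (G : {group gT}) (lam : gT -> R[i]) : Prop :=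
  exists (d : nat) (rG : mx_representation R[i] G d),
    mx_irreducible rG /\ {in G, forall g, lam g = \tr (rG g)}.

Section CartesianSymmetrizer.

Variables (R : realType) (V : vectType R[i]) (n m : nat).
Variables (f : n.-tuple V) (G : {group 'S_m}) (lam : 'S_m -> R[i]).

Definition cart_basis (i : 'I_n) (j : 'I_m) : {ffun 'I_m -> V} :=
  [ffun k => if k == j then tnth f i else 0].

Definition cart_perm (tau : 'S_m) (u : {ffun 'I_m -> V}) : {ffun 'I_m -> V} :=
  [ffun k => u ((tau^-1)%g k)].

Definition cart_sym (u : {ffun 'I_m -> V}) : {ffun 'I_m -> V} :=
  (lam 1%g / #|G|%:R) *: \sum_(tau in G) lam tau *: cart_perm tau u.

Definition cart_sym_basis (i : 'I_n) (j : 'I_m) : {ffun 'I_m -> V} :=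
  cart_sym (cart_basis i j).

Definition stab_prod (j : 'I_m) : R[i] :=
  #|'C_G[j | 'P]|%:R^-1 * \sum_(g in 'C_G[j | 'P]) lam g.

Definition orbit_reps (D : {set 'I_m}) : Prop :=
  is_transversal D [set orbit 'P G j | j : 'I_m] [set: 'I_m].

Definition nonzero_indices : {set 'I_m} := [set j | stab_prod j != 0].

Definition cyclic_subspace (i : 'I_n) (j : 'I_m) : {vspace {ffun 'I_m -> V}} :=
  <<[seq cart_sym_basis i ((sigma : 'S_m) j) | sigma in G]>>%VS.

End CartesianSymmetrizer.

(* Main.v *)
(* In the independent family (f_ik)_k, the restriction of C_lambda to the span
   of the f_ik with k in the orbit of j has matrix P A, with P the projection
   onto the orbit coordinates and A the symmetrizer in the permutation
   representation. By Schur orthogonality, lambda * lambda = |G|/lambda(1)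
   lambda for the convolution product, so A is idempotent; A commutes with P,
   hence P A is idempotent and its rank is its trace, which sums
   lambda(1)/|G| times the sum of lambda over G_k for k in the orbit of j. *)

Require Import Defs.
From HB Require Import structures.
From mathcomp Require Import all_boot all_order all_fingroup all_algebra.
From mathcomp Require Import mxrepresentation complex reals.

Set Implicit Arguments.
Unset Strict Implicit.
Unset Printing Implicit Defensive.

Import Order.TTheory GroupScope GRing.Theory Num.Theory.
Local Open Scope ring_scope.

(** * Schur's lemma and orthogonality for irreducible traces *)

Section IrreducibleTrace.

Variables (C : numClosedFieldType) (gT : finGroupType) (G : {group gT}).
Variables (d : nat) (rG : mx_representation C G d).
Hypothesis irrG : mx_irreducible rG.

Lemma mx_irr_dim_gt0 : (0 < d)%N.
Proof. by have /mx_irrP[] := irrG. Qed.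

(** Over an algebraically closed field [B] has an eigenvalue [a]. By Schur's lemma [B - a%:M], if
    nonzero, would be invertible, yet it kills an eigenvector. *)
Lemma centgmx_scalar (B : 'M_d) : centgmx rG B -> exists a, B = a%:M.
Proof.
move=> /centgmxP cB; have [a aB] := eigenvalue_closed B mx_irr_dim_gt0.
exists a; apply/eqP; rewrite -subr_eq0; apply/negPn/negP => nz.
have cBa : centgmx rG (B - a%:M).
  by apply/centgmxP => g Gg; rewrite mulmxBl mulmxBr cB // scalar_mxC.
have /eigenvalueP[v Bv nz_v] := aB.
have := mx_Schur irrG cBa nz; rewrite -row_free_unit => /row_free_inj inj_Ba.
case/eqP: nz_v; apply: inj_Ba.
by rewrite mul0mx mulmxBr Bv mul_mx_scalar subrr.
Qed.

(** Reindexing by [g * h] shows that the sum commutes with each [rG h], so it is scalar; comparing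
    traces gives the scalar. *)
Lemma repr_average_scalar (B : 'M_d) :
  \sum_(g in G) rG g^-1%g *m B *m rG g = (#|G|%:R * \tr B / d%:R)%:M.
Proof.
set S := \sum_(g in G) _.
have d_neq0 : d%:R != 0 :> C by rewrite pnatr_eq0 -lt0n mx_irr_dim_gt0.
have [|a Sa] := @centgmx_scalar S.
  apply/centgmxP => h Gh; rewrite /S mulmx_suml mulmx_sumr.
  rewrite [RHS](reindex_inj (mulIg h)) /=; apply: eq_big => [g|g Gg].
    by rewrite groupMr.
  by rewrite invMg !repr_mxM ?groupV // !mulmxA -(repr_mxM rG Gh) ?groupV //
    mulgV repr_mx1 mul1mx.
have trS : \tr S = #|G|%:R * \tr B.
  rewrite raddf_sum -sum1_card natr_sum mulr_suml /=; apply: eq_bigr => g Gg.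
  by rewrite mxtrace_mulC mulmxA -repr_mxM ?groupV // mulgV repr_mx1 mul1mx mul1r.
by rewrite -trS Sa mxtrace_scalar -[a *+ d]mulr_natr mulfK.
Qed.

Lemma mxtrace_repr_conv h : h \in G ->
  \sum_(g in G) \tr (rG g) * \tr (rG (g^-1 * h)%g)
    = #|G|%:R / d%:R * \tr (rG h).
Proof.
move=> Gh.
(* Average the matrix units [delta_mx k l], then read off the entry (k, l). *)
have entry k l : \sum_(g in G) rG g k k * rG (g^-1 * h)%g l l
    = #|G|%:R / d%:R * ((k == l)%:R * rG h k l).
  transitivity (((\sum_(g in G) rG g^-1%g *m delta_mx k l *m rG g) *m rG h) k l).
    rewrite mulmx_suml summxE [RHS](reindex_inj invg_inj) /=.
    apply: eq_big => [g|g Gg]; first by rewrite groupV.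
    rewrite invgK -mulmxA -repr_mxM ?groupV // -mulmxA mxE (bigD1 k) //=.
    rewrite big1 => [|q q_neq_k].
      rewrite addr0 mxE (bigD1 l) //= big1 => [|q q_neq_l].
        by rewrite mxE !eqxx mul1r addr0.
      by rewrite mxE (negPf q_neq_l) andbF mul0r.
    rewrite [X in _ * X]mxE big1 ?mulr0 // => s _.
    by rewrite mxE (negPf q_neq_k) mul0r.
  have tr_delta : \tr (delta_mx k l) = (k == l)%:R :> C.
    rewrite /mxtrace (bigD1 k) //= big1 => [|q q_neq].
      by rewrite mxE eqxx addr0.
    by rewrite mxE (negPf q_neq).
  by rewrite repr_average_scalar tr_delta mul_scalar_mx mxE [X in X * _]mulrAC mulrA.
(* Summing [entry] over all [k] and [l] gives the products of traces; on the other side only [k = l]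
   survives. *)
transitivity (\sum_k \sum_l \sum_(g in G) rG g k k * rG (g^-1 * h)%g l l).
  under [RHS]eq_bigr do rewrite exchange_big /=.
  rewrite [RHS]exchange_big /=; apply: eq_bigr => g _.
  by rewrite /mxtrace mulr_suml; apply: eq_bigr => k _; rewrite mulr_sumr.
rewrite /mxtrace mulr_sumr; apply: eq_bigr => k _.
rewrite (bigD1 k) //= [X in _ + X]big1 ?addr0 => [|l l_neq]; rewrite entry.
  by rewrite eqxx mul1r.
by rewrite eq_sym (negPf l_neq) mul0r mulr0.
Qed.

End IrreducibleTrace.

(** In the rank factorization of [P] into [col_base P] and [row_base P], idempotence forces the
    product in reverse order to be the identity of size [\rank P]. *)
Lemma mxtrace_idempotent (F : fieldType) n (P : 'M[F]_n) :
  P *m P = P -> \tr P = (\rank P)%:R.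
Proof.
move=> idP; have RC : row_base P *m col_base P = 1%:M.
  apply/(row_full_inj (col_base_full P))/(row_free_inj (row_base_free P)).
  by rewrite mulmx1 mulmxA -mulmxA mulmx_base.
by rewrite -{1}(mulmx_base P) mxtrace_mulC RC mxtrace1.
Qed.

(** * Dimension of a span as the rank of a coordinate matrix *)

Section SpanRows.

Variables (F : fieldType) (W : vectType F) (m : nat) (e : 'I_m -> W).

Definition row_comb p (A : 'M[F]_(p, m)) (k : 'I_p) : W :=
  \sum_(l < m) A k l *: e l.

Lemma span_row_comb_sub p q (A : 'M_(p, m)) (B : 'M_(q, m)) : (A <= B)%MS ->
  (<<codom (row_comb A)>> <= <<codom (row_comb B)>>)%VS.
Proof.
case/submxP=> X ->; apply/span_subvP => _ /codomP[k ->].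
have -> : row_comb (X *m B) k = \sum_h X k h *: row_comb B h.
  rewrite /row_comb; under [RHS]eq_bigr do rewrite scaler_sumr.
  rewrite exchange_big; apply: eq_bigr => l _ /=; rewrite mxE scaler_suml.
  by apply: eq_bigr => h _; rewrite scalerA.
by apply: memv_suml => h _; apply/memvZ/memv_span/codom_f.
Qed.

Hypothesis e_free : forall c : 'I_m -> F,
  \sum_l c l *: e l = 0 -> forall l, c l = 0.

(** Passing to [row_base A] keeps the span and leaves [\rank A] independent rows, whose combinations
    of the free family [e] are again independent. *)
Lemma dim_span_row_comb p (A : 'M_(p, m)) :
  \dim <<codom (row_comb A)>> = \rank A.
Proof.
have -> : <<codom (row_comb A)>>%VS = <<codom (row_comb (row_base A))>>%VS.
  by apply: subv_anti; rewrite !span_row_comb_sub // eq_row_base.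
set X := codom _; suff /eqP -> : free X by rewrite size_codom card_ord.
pose X' := [tuple row_comb (row_base A) k | k < \rank A].
have -> : X = X' by rewrite /X /codom /image_mem.
apply/freeP => c; under eq_bigr do rewrite nth_mktuple.
pose v : 'rV_(\rank A) := \row_k c k.
move=> c0; have v0 : v *m row_base A = 0.
  apply/rowP => l; rewrite [RHS]mxE.
  apply: (e_free (c := fun l => (v *m row_base A) 0 l)).
  rewrite -[RHS]c0 /row_comb; under [RHS]eq_bigr do rewrite scaler_sumr.
  rewrite exchange_big; apply: eq_bigr => {}l _ /=; rewrite mxE scaler_suml.
  by apply: eq_bigr => h _; rewrite mxE scalerA.
have /rowP v0' : v = 0.
  by apply: (row_free_inj (row_base_free A)); rewrite v0 mul0mx.
by move=> k; have := v0' k; rewrite !mxE.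
Qed.

End SpanRows.

(** * The symmetrizer in the permutation representation *)

Section SymmetrizerMatrix.

Variables (C : numClosedFieldType) (m : nat) (G : {group 'S_m}).
Variable lam : 'S_m -> C.

(** Row convention: row [k] will hold the coordinates of the symmetrized [k]-th basis vector. *)
Definition sym_mx : 'M[C]_m :=
  (lam 1%g / #|G|%:R) *: \sum_(s in G) lam s *: perm_mx s.

Definition orbit_proj_mx (j : 'I_m) : 'M[C]_m :=
  diag_mx (\row_k (k \in orbit 'P G j)%:R).

Lemma sym_mxE k l :
  sym_mx k l = lam 1%g / #|G|%:R * \sum_(s in G | s k == l) lam s.
Proof.
rewrite mxE summxE big_mkcondr; congr (_ * _); apply: eq_bigr => s _.
by rewrite 3!mxE; case: eqP; rewrite (mulr1, mulr0).
Qed.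

Lemma orbit_proj_sym_mxE j k l :
  (orbit_proj_mx j *m sym_mx) k l = (k \in orbit 'P G j)%:R * sym_mx k l.
Proof. by rewrite mul_diag_mx !mxE. Qed.

Lemma orbit_proj_idem j : orbit_proj_mx j *m orbit_proj_mx j = orbit_proj_mx j.
Proof.
rewrite mulmx_diag; congr diag_mx; apply/rowP => k; rewrite !mxE.
by rewrite -natrM mulnb andbb.
Qed.

Lemma orbit_proj_perm_comm j s : s \in G ->
  orbit_proj_mx j *m perm_mx s = perm_mx s *m orbit_proj_mx j.
Proof.
move=> Gs; apply/matrixP => k l; rewrite mul_diag_mx mul_mx_diag !mxE.
case: eqP => [<-|_]; last by rewrite mulr0 mul0r.
rewrite mulr1 mul1r; congr (_ : bool)%:R.
by rewrite -[s k]/('P%act k s) orbit_actr.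
Qed.

Lemma orbit_proj_sym_comm j :
  orbit_proj_mx j *m sym_mx = sym_mx *m orbit_proj_mx j.
Proof.
rewrite -scalemxAr -scalemxAl mulmx_sumr mulmx_suml; congr (_ *: _).
by apply: eq_bigr => s Gs; rewrite -scalemxAr -scalemxAl orbit_proj_perm_comm.
Qed.

(** These three properties are what is retained of an irreducible character, with [lam 1] as its
    degree. *)
Hypothesis lam1_neq0 : lam 1%g != 0.
Hypothesis lam_conv : {in G, forall h,
  \sum_(g in G) lam g * lam (g^-1 * h)%g = #|G|%:R / lam 1%g * lam h}.
Hypothesis lam_class : {in G &, forall g h, lam (g ^ h)%g = lam g}.

Lemma sym_mx_idem : sym_mx *m sym_mx = sym_mx.
Proof.
have G_neq0 : #|G|%:R != 0 :> C by rewrite pnatr_eq0 -lt0n cardG_gt0.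
rewrite -scalemxAl -scalemxAr; congr (_ *: _).
(* Permutation matrices multiply as in [G], so the coefficients of the product are the convolution
   of [lam] with itself. *)
transitivity ((lam 1%g / #|G|%:R) *:
    \sum_(h in G) (\sum_(g in G) lam g * lam (g^-1 * h)%g) *: perm_mx h : 'M[C]_m).
  congr (_ *: _); rewrite mulmx_suml.
  under [RHS]eq_bigr do rewrite scaler_suml.
  rewrite [RHS]exchange_big /=; apply: eq_bigr => g Gg.
  rewrite mulmx_sumr [RHS](reindex_inj (mulgI g)) /=.
  apply: eq_big => [h|h _]; first by rewrite groupMl.
  by rewrite -scalemxAl -scalemxAr scalerA perm_mxM mulKg.
rewrite scaler_sumr; apply: eq_bigr => h Gh; rewrite scalerA lam_conv //.
by rewrite mulrA -[lam 1%g / _]invf_div mulVf ?mul1r // mulf_neq0 ?invr_eq0.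
Qed.

(** Stabilizers of points in one orbit are conjugate in [G], and [lam] is a class function. *)
Lemma sum_stab_orbit j k : k \in orbit 'P G j ->
  \sum_(s in G | s k == k) lam s = \sum_(s in 'C_G[j | 'P]) lam s.
Proof.
case/orbitP=> h Gh <-; rewrite (reindex_inj (conjg_inj h)) /=.
apply: eq_big => [s|s /andP[Gs _]]; last first.
  by rewrite lam_class // -(groupJr _ Gh).
rewrite inE groupJr //; congr (_ && _).
rewrite -[_ == _]/('P%act ('P%act j h) (s ^ h)%g == 'P%act j h).
rewrite -(sameP astab1P eqP) astab1_act memJ_conjg.
by apply/astab1P/astab1P.
Qed.

Lemma rank_orbit_sym_mx j : (\rank (orbit_proj_mx j *m sym_mx))%:R =
  lam 1%g * (#|'C_G[j | 'P]|%:R^-1 * \sum_(g in 'C_G[j | 'P]) lam g).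
Proof.
set S := \sum_(g in _) _.
rewrite -mxtrace_idempotent; last first.
  rewrite mulmxA -[X in X *m _]mulmxA -orbit_proj_sym_comm.
  by rewrite mulmxA orbit_proj_idem -mulmxA sym_mx_idem.
transitivity (\sum_(k in orbit 'P G j) lam 1%g / #|G|%:R * S).
  rewrite [RHS]big_mkcond; apply: eq_bigr => k _.
  rewrite orbit_proj_sym_mxE sym_mxE; case: ifP => [jk|_]; last by rewrite mul0r.
  by rewrite mul1r (sum_stab_orbit jk).
(* The summand is constant on the orbit; the orbit-stabilizer formula turns [#|orbit| / #|G|] into
   the inverse order of the stabilizer. *)
rewrite sumr_const -[LHS]mulr_natr.
have -> : #|G|%:R = #|orbit 'P G j|%:R * #|'C_G[j | 'P]|%:R :> C.
  by rewrite -natrM card_orbit_stab.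
have O_neq0 : #|orbit 'P G j|%:R != 0 :> C.
  by rewrite pnatr_eq0 -lt0n; apply/card_gt0P; exists j; apply: orbit_refl.
rewrite invfM -!mulrA; congr (_ * _); rewrite mulrCA; congr (_ * _).
by rewrite mulrC -mulrA divff ?mulr1.
Qed.

End SymmetrizerMatrix.

(** * Coordinates of the cyclic subspace *)

Section CyclicSubspace.

Variables (R : realType) (V : vectType R[i]) (n m : nat).
Variables (f : n.-tuple V) (G : {group 'S_m}) (lam : 'S_m -> R[i]).

Lemma cart_sym_basisE i k : cart_sym_basis f G lam i k =
  row_comb (cart_basis f i) (sym_mx G lam) k.
Proof.
apply/ffunP => q; rewrite sum_ffunE (bigD1 q) //= big1 => [|l l_neq]; last first.
  by rewrite !ffunE eq_sym (negPf l_neq) scaler0.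
rewrite addr0 !ffunE eqxx sum_ffunE sym_mxE -[RHS]scalerA scaler_suml big_mkcondr.
congr (_ *: _); apply: eq_bigr => s _.
(* As [s^-1 q = k] means [q = s k], [cart_perm s] moves the [k]-th basis vector to the one at [s k],
   matching [perm_mx s]. *)
rewrite !ffunE (canF_eq (permKV s)) eq_sym.
by case: eqP => _; rewrite ?scaler0.
Qed.

Lemma cart_basis_free i (c : 'I_m -> R[i]) : free f ->
  \sum_l c l *: cart_basis f i l = 0 -> forall l, c l = 0.
Proof.
move=> f_free c0 l; move/ffunP: c0 => /(_ l).
rewrite sum_ffunE (bigD1 l) //= big1 => [|q q_neq]; last first.
  by rewrite !ffunE eq_sym (negPf q_neq) scaler0.
rewrite addr0 !ffunE eqxx => /eqP; rewrite scaler_eq0 => /orP[/eqP //|/eqP fi0].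
by have := free_not0 f_free (mem_tnth i f); rewrite fi0 eqxx.
Qed.

(** Rows outside the orbit of [j] are zero and add nothing to the span. *)
Lemma cyclic_subspaceE i j : cyclic_subspace f G lam i j =
  <<codom (row_comb (cart_basis f i) (orbit_proj_mx _ G j *m sym_mx G lam))>>%VS.
Proof.
have row_orbitE k : row_comb (cart_basis f i) (orbit_proj_mx _ G j *m sym_mx G lam) k
    = (k \in orbit 'P G j)%:R *: cart_sym_basis f G lam i k.
  rewrite cart_sym_basisE scaler_sumr; apply: eq_bigr => l _.
  by rewrite orbit_proj_sym_mxE scalerA.
apply: subv_anti; apply/andP; split; apply/span_subvP => w.
  case/imageP=> s Gs ->; apply: memv_span; apply/codomP; exists (s j).
  by rewrite row_orbitE -[s j]/('P%act j s) mem_orbit // scale1r.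
case/codomP=> k ->; rewrite row_orbitE.
case: orbitP => [[s Gs <-]|_]; last by rewrite scale0r mem0v.
by rewrite scale1r; apply: memv_span; apply: image_f.
Qed.

End CyclicSubspace.

Theorem theorem2p1 (R : realType) (n m : nat)
    (V : vectType R[i]) (dot : {dot V for @Num.conj R[i]})
    (f : n.-tuple V) (G : {group 'S_m}) (lam : 'S_m -> R[i])
    (D : {set 'I_m})
    (n_ge2 : (2 <= n)%N)
    (dimV : \dim {:V} = n)
    (f_basis : basis_of {:V} f)
    (f_orthonormal : orthonormal dot f)
    (lam_irr : irr_character G lam)
    (D_reps : orbit_reps G D)
    (i : 'I_n) (j : 'I_m) (j_in : j \in D :&: nonzero_indices G lam) :
  (\dim (cyclic_subspace f G lam i j))%:R = lam 1%g * stab_prod G lam j.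
Proof.
have [d [rG [irrG lamE]]] := lam_irr.
have lam1 : lam 1%g = d%:R by rewrite lamE // repr_mx1 mxtrace1.
have lam1_neq0 : lam 1%g != 0.
  by rewrite lam1 pnatr_eq0 -lt0n (mx_irr_dim_gt0 irrG).
rewrite cyclic_subspaceE dim_span_row_comb; last first.
  by move=> c; apply/cart_basis_free/(basis_free f_basis).
(* The convolution identity comes from Schur orthogonality, invariance under conjugation from
   cyclicity of the trace. *)
apply: rank_orbit_sym_mx => // [h Gh|g h Gg Gh].
  rewrite lam1 lamE // -(mxtrace_repr_conv irrG Gh).
  by apply: eq_bigr => g Gg; rewrite !lamE ?groupM ?groupV.
rewrite !lamE ?groupJ // conjgE !repr_mxM ?groupM ?groupV //.
by rewrite mulmxA mxtrace_mulC mulmxA -repr_mxM ?groupV // mulgV repr_mx1 mul1mx.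
Qed.
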